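(* Let $v\in\{0,1\}^m$, $\eta$ a vector of positive integers of length $\zeta^v(m)$, and $k=|\{j:v(j)=0\}|+\sum_i\eta(i)$. Let $D_1,\dots,D_r$ be directed graphs with $V(D_i)=\{d^i_1,\dots,d^i_{n_i}\}$, and let $\phi_i:V(D_i)\to\{1,\dots,k\}$ be injective functions with $\phi_i(V(D_i))\cap\phi_j(V(D_j))=\emptyset$ for $i\ne j$, such that each $D_i$ is $(v,\eta,\phi_i)$-proper. Then for every $c>0$ there exist $\lambda_0>0$ and $c_1>0$ such that for every tournament $T$, every $0<\lambda\le\lambda_0$ and every $(v,\eta,c,\lambda)$-m-sequence $\chi$ in $T$ with $l(\chi)=(T_1,\dots,T_k)$, either $\chi$ contains a $c_1$-strong pair, or there exist vertices $x^i_j\in T_{\phi_i(d^i_j)}$ ($1\le i\le r$, $1\le j\le n_i$) such that: (a) for every $i$, if $(d^i_a,d^i_b)$ is an edge of $D_i$ then $(x^i_a,x^i_b)$ is an edge of $T$; and (b) for all $i\ne i'$ and all $a,b$ with $\phi_i(d^i_a)>\phi_{i'}(d^{i'}_b)$, $(x^i_a,x^{i'}_b)$ is not an edge of $T$.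
   Context: Tournaments are finite; transitive = no directed cycle; $tr(T)$ = maximum size of a transitive subtournament of $T$. $V_1$ is complete to $V_2$ if every vertex of $V_1$ has an edge to every vertex of $V_2$. For disjoint nonempty $X,Y$, $d(X,Y)=e_{X,Y}/(|X||Y|)$, $e_{X,Y}$ = number of edges $(x,y)$ with $x\in X,y\in Y$. $\zeta^v(i)=|\{j\le i:v(j)=1\}|$. For a tournament $T$, $c>0$, $0\le\lambda<1$, a $(v,\eta,c,\lambda)$-m-sequence in $T$ is a sequence $\chi=(S_1,\dots,S_m)$ of pairwise disjoint subsets of $V(T)$ such that: if $v(i)=1$, $S_i$ induces a transitive subtournament partitioned into $S_{i,1},\dots,S_{i,\eta(\zeta^v(i))}$ with $S_{i,a}$ complete to $S_{i,b}$ for $a<b$ and $|S_{i,a}|\ge c\,tr(T)$; if $v(i)=0$, $|S_i|\ge c|T|$; $d(S_i,S_j)\ge1-\lambda$ for $i<j$. Its long representation $l(\chi)=(T_1,\dots,T_k)$ replaces each $S_i$ with $v(i)=1$ by $S_{i,1},\dots,S_{i,\eta(\zeta^v(i))}$ in order; $V(\chi)=\bigcup S_i$. A $c'$-strong pair in $\chi$ is a pair $(A,B)$ of disjoint subsets of $V(\chi)$ with $|A|\ge c'|T|$, either $|B|\ge c'|T|$ or ($B$ transitive and $|B|\ge c'\,tr(T)$), and $d(A,B)=1$ or $d(B,A)=1$. A directed graph $D$ with $V(D)=\{d_1,\dots,d_n\}$ and injective $\phi:V(D)\to\{1,\dots,k\}$ is $(v,\eta,\phi)$-proper if for every $c>0$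 there is $c_1>0$ (depending only on $v,\eta,c$) such that for every tournament $T$, every $0\le\lambda<1$ and every $(v,\eta,c,\lambda)$-m-sequence $\chi$ in $T$ with $l(\chi)=(T_1,\dots,T_k)$, either there exist $x_j\in T_{\phi(d_j)}$ ($1\le j\le n$) such that $(x_a,x_b)$ is an edge of $T$ whenever $(d_a,d_b)$ is an edge of $D$, or $\chi$ contains a $c_1$-strong pair. *)

(* Defs.v *)
From HB Require Import structures.
From mathcomp Require Import all_boot all_order all_algebra.
From mathcomp Require Import boolp reals.
Set Implicit Arguments.
Unset Strict Implicit.
Unset Printing Implicit Defensive.
Import Order.TTheory GRing.Theory Num.Theory.
Local Open Scope ring_scope.

(* Tournaments are nonempty: the densities below are only meaningful between
   nonempty sets, and [#|S| >= c * #|V|] with [c > 0] must force [S] to be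
   nonempty. *)
Definition is_tournament (V : finType) (e : rel V) : Prop :=
  [/\ (0 < #|V|)%N, irreflexive e & forall x y, x != y -> e x y = ~~ e y x].

Definition transitive_set (V : finType) (e : rel V) (S : {set V}) : Prop :=
  forall p : seq V, p != [::] -> {subset p <= S} -> ~ ucycle e p.

Definition tr (V : finType) (e : rel V) : nat :=
  \max_(S : {set V} | `[< transitive_set e S >]) #|S|.

Definition complete_to (V : finType) (e : rel V) (X Y : {set V}) : Prop :=
  forall x y, x \in X -> y \in Y -> e x y.

(* If [X] or [Y] is empty, this is 0 because [0^-1 = 0]. *)
Definition density (R : realType) (V : finType) (e : rel V) (X Y : {set V}) : R :=
  #|[set p in setX X Y | e p.1 p.2]|%:R / (#|X|%:R * #|Y|%:R).

(* Coordinates of [v] are numbered from 0, so this counts the ones among the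
   first [i] entries.  If the entry numbered [i] is a one, it is the one of
   (0-based) rank [zeta v i], hence the length of its subdivision is the entry
   numbered [zeta v i] of [eta]. *)
Definition zeta (m : nat) (v : m.-tuple bool) (i : nat) : nat :=
  #|[set j : 'I_m | (j < i)%N && tnth v j]|.

Definition long_size (m : nat) (v : m.-tuple bool)
    (eta : (zeta v m).-tuple nat) : nat :=
  (#|[set j : 'I_m | ~~ tnth v j]| + \sum_(i < zeta v m) tnth eta i)%N.

(* [parts chi i] lists [S_(i,1), S_(i,2)] and so on; it is irrelevant when the
   entry of [v] numbered [i] is zero. *)
Record mseq (m : nat) (V : finType) := MSeq {
  blocks : 'I_m -> {set V};
  parts : 'I_m -> seq {set V}
}.

Definition is_mseq (R : realType) (m : nat) (v : m.-tuple bool)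
    (eta : (zeta v m).-tuple nat) (c lambda : R)
    (V : finType) (e : rel V) (chi : mseq m V) : Prop :=
  [/\ 0 < c /\ 0 <= lambda < 1,
      forall i j, i != j -> [disjoint blocks chi i & blocks chi j],
      forall i, tnth v i ->
        [/\ transitive_set e (blocks chi i),
            size (parts chi i) = nth 0%N eta (zeta v i),
            uniq (parts chi i) /\
              partition [set X in parts chi i] (blocks chi i),
            forall a b, (a < b < size (parts chi i))%N ->
              complete_to e (nth set0 (parts chi i) a) (nth set0 (parts chi i) b)
          & forall X, X \in parts chi i -> c * (tr e)%:R <= #|X|%:R],
      forall i, ~~ tnth v i -> c * #|V|%:R <= #|blocks chi i|%:R
    & forall i j : 'I_m, (i < j)%N ->
        1 - lambda <= density R e (blocks chi i) (blocks chi j)].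

Definition long_rep (m : nat) (v : m.-tuple bool) (V : finType)
    (chi : mseq m V) : seq {set V} :=
  flatten [seq if tnth v i then parts chi i else [:: blocks chi i]
          | i <- enum 'I_m].

Definition vertices (m : nat) (V : finType) (chi : mseq m V) : {set V} :=
  \bigcup_(i < m) blocks chi i.

Definition has_strong_pair (R : realType) (m : nat) (V : finType) (e : rel V)
    (chi : mseq m V) (c : R) : Prop :=
  exists A B : {set V},
    [/\ A \subset vertices chi, B \subset vertices chi & [disjoint A & B]] /\
    [/\ c * #|V|%:R <= #|A|%:R,
        c * #|V|%:R <= #|B|%:R \/
          (transitive_set e B /\ c * (tr e)%:R <= #|B|%:R)
      & density R e A B = 1 \/ density R e B A = 1].

(* A directed graph with vertices [d_1, ..., d_n] is a relation on ['I_n]. *)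
Definition proper_digraph (R : realType) (m : nat) (v : m.-tuple bool)
    (eta : (zeta v m).-tuple nat) (n : nat) (D : rel 'I_n)
    (phi : 'I_n -> 'I_(long_size eta)) : Prop :=
  forall c : R, 0 < c ->
  exists2 c1 : R, 0 < c1 &
  forall (V : finType) (e : rel V), is_tournament e ->
  forall lambda : R, 0 <= lambda < 1 ->
  forall chi : mseq m V, is_mseq eta c lambda e chi ->
    (exists x : 'I_n -> V,
        (forall j, x j \in nth set0 (long_rep v chi) (phi j)) /\
        (forall a b, D a b -> e (x a) (x b))) \/
    has_strong_pair e chi c1.

(* Main.v *)
Require Import Defs.
From HB Require Import structures.
From mathcomp Require Import all_boot all_order all_algebra.
From mathcomp Require Import boolp reals.
From mathcomp Require Import ring lra.
Set Implicit Arguments.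
Unset Strict Implicit.
Unset Printing Implicit Defensive.
Import Order.TTheory GRing.Theory Num.Theory.
Local Open Scope ring_scope.

(** For small [lambda], a Markov argument leaves in every set of the long
    representation at least half of its vertices after removing those with many
    wrongly oriented pairs towards some other set.  The copies of the [D i] are
    then found one after the other: deleting the few vertices in a wrongly
    oriented pair with an already chosen vertex keeps a quarter of every set, so
    the restriction of [chi] to the remaining vertices is still an m-sequence
    with [c / 4] in place of [c], to which the properness of the next [D i]
    applies.  Since properness is uniform in [lambda < 1], this restriction need
    only have one forward edge between any two blocks. *)

(** Splits a pairwise property of a long representation into one case inside a block and one case
    across two blocks. *)
Lemma pairwise_flatten_map (I T : Type) (lt : rel I) (r : rel T)
    (F : I -> seq T) (s : seq I) :
  pairwise lt s -> (forall i, pairwise r (F i)) ->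
  (forall i j, lt i j -> allrel r (F i) (F j)) ->
  pairwise r (flatten (map F s)).
Proof.
move=> + Fi Fij; elim: s => [|i s IHs] //= /andP[lt_is /IHs rs].
rewrite pairwise_cat Fi rs !andbT.
elim: s lt_is {IHs rs} => [|j s IHs] /=; first by rewrite allrel0r.
by case/andP=> /Fij rij /IHs ris; rewrite allrel_catr rij ris.
Qed.

(** * Sparse relations: degrees and the Markov argument *)

Section Sparse.

Variables (R : realType) (V : finType).
Implicit Types (bad : rel V) (X Y U : {set V}) (L : seq {set V}).

Definition degree_in bad (x : V) Y : nat := #|[set y in Y | bad x y]|.

Definition typical bad L (eps : R) : {set V} :=
  [set x | all (fun Y => (degree_in bad x Y)%:R <= eps * #|Y|%:R) L].

Lemma sum_degree_in bad X Y :
  (\sum_(x in X) degree_in bad x Y = \sum_(x in X) \sum_(y in Y) bad x y)%N.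
Proof.
apply: eq_bigr => x _; rewrite /degree_in -sum1dep_card big_mkcondr /=.
by apply: eq_bigr => y _; case: (bad x y).
Qed.

Lemma degree_inS bad x Y Y' :
  Y \subset Y' -> (degree_in bad x Y <= degree_in bad x Y')%N.
Proof.
move=> /subsetP sYY'; apply/subset_leq_card/subsetP => y.
by rewrite !inE => /andP[/sYY' -> ->].
Qed.

Lemma sum_degree_inS bad X X' Y Y' : X \subset X' -> Y \subset Y' ->
  (\sum_(x in X) degree_in bad x Y <= \sum_(x in X') degree_in bad x Y')%N.
Proof.
move=> sXX' sYY'; rewrite [leqRHS](big_setID X) /= (setIidPr sXX').
by apply: leq_trans (leq_addr _ _); apply: leq_sum => x _; apply: degree_inS.
Qed.

Lemma sum_degree_in_swap bad X Y :
  (\sum_(x in X) degree_in bad x Y =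
   \sum_(y in Y) degree_in (fun y x => bad x y) y X)%N.
Proof. by rewrite !sum_degree_in exchange_big. Qed.

(** Markov's inequality: each of the counted vertices contributes more than [eps * #|Y|] to the sum
    of degrees. *)
Lemma card_high_degree bad X Y (delta eps : R) :
  0 < eps -> 0 <= delta ->
  (\sum_(x in X) degree_in bad x Y)%N%:R <= delta * (#|X|%:R * #|Y|%:R) ->
  #|[set x in X | eps * #|Y|%:R < (degree_in bad x Y)%:R]|%:R * eps
    <= delta * #|X|%:R.
Proof.
move=> eps_gt0 delta_ge0 sum_le; set M := [set x in X | _].
(* The factor [#|Y|] can be cancelled only if it is nonzero; for empty [Y] every degree is 0, so [M]
   is empty. *)
have [Y0|Y_gt0] := posnP #|Y|.
  rewrite (_ : M = set0) ?cards0 ?mul0r; last first.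
    apply/setP=> x; rewrite !inE Y0 mulr0 ltr0n; apply/negP=> /andP[_].
    by rewrite ltnNge -Y0 subset_leq_card //; apply/subsetP=> y; rewrite !inE => /andP[].
  by rewrite mulr_ge0.
have Y_pos : 0 < #|Y|%:R :> R by rewrite ltr0n.
rewrite -(ler_pM2r Y_pos) -[leRHS]mulrA; apply: le_trans sum_le.
rewrite -mulrA mulr_natl -sumr_const natr_sum [leRHS](big_setID M) /=.
rewrite (_ : X :&: M = M); last first.
  by apply/setIidPr/subsetP=> x; rewrite !inE => /andP[].
rewrite -[leLHS]addr0 lerD ?sumr_ge0 //.
by apply: ler_sum => x; rewrite inE => /andP[_ /ltW].
Qed.

(** Union bound: an atypical vertex has high degree into some member of [L], and each member
    accounts for at most [delta / eps] of [X]. *)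
Lemma card_atypical bad L X (delta eps : R) :
  0 < eps -> 0 <= delta ->
  (forall Y, Y \in L ->
    (\sum_(x in X) degree_in bad x Y)%N%:R <= delta * (#|X|%:R * #|Y|%:R)) ->
  #|X :\: typical bad L eps|%:R * eps <= (size L)%:R * (delta * #|X|%:R).
Proof.
move=> eps_gt0 delta_ge0; elim: L => [|Y L IHL] sum_le.
  rewrite mul0r (_ : _ :\: _ = set0) ?cards0 ?mul0r //.
  by apply/setP=> x; rewrite !inE.
have {}IHL := IHL (fun Z ZL => sum_le Z (@mem_behead _ (Y :: L) Z ZL)).
have hY := card_high_degree eps_gt0 delta_ge0 (sum_le Y (mem_head _ _)).
set M := [set x in X | _] in hY.
have sub : X :\: typical bad (Y :: L) eps \subset M :|: X :\: typical bad L eps.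
  apply/subsetP=> x; rewrite !inE /= negb_and -ltNge => /andP[/orP[->|->] ->] //.
  by rewrite orbT.
have := leq_trans (subset_leq_card sub) (leq_card_setU _ _).
rewrite -(ler_nat R) natrD /= => le_card.
rewrite -natr1 mulrDl mul1r addrC.
by apply: le_trans (lerD hY IHL); rewrite -mulrDl ler_wpM2r // ltW.
Qed.

End Sparse.

(** * Density bounds as bounds on the number of non-edges *)

Lemma card_edges (V : finType) (e : rel V) (X Y : {set V}) :
  (#|[set p in setX X Y | e p.1 p.2]|
     + \sum_(x in X) degree_in (fun x y => ~~ e x y) x Y = #|X| * #|Y|)%N.
Proof.
rewrite -sum1_card (eq_bigl (fun p => (p.1 \in X) && ((p.2 \in Y) && e p.1 p.2)));
  last by move=> p; rewrite !inE andbA.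
rewrite -(pair_big_dep (fun x => x \in X) (fun x y => (y \in Y) && e x y)
                       (fun _ _ => 1%N)) /=.
rewrite -big_split -sum_nat_const /=; apply: eq_bigr => x _.
rewrite sum1dep_card -(cardsID [set y | e x y] Y) /degree_in.
by congr (_ + _)%N; apply: eq_card => y; rewrite !inE // andbC.
Qed.

Lemma nonedges_density (R : realType) (V : finType) (e : rel V)
    (X Y : {set V}) (lambda : R) :
  1 - lambda <= density R e X Y ->
  (\sum_(x in X) degree_in (fun x y => ~~ e x y) x Y)%N%:R
    <= lambda * (#|X|%:R * #|Y|%:R).
Proof.
have := card_edges e X Y; rewrite /density; set E := #|_|; set N := (\sum_(x in X) _)%N.
(* If [X] or [Y] is empty, the density is only a default value, but both sides of the goal are 0. *)
move=> EN; have [XY0|XY_gt0] := posnP (#|X| * #|Y|).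
  rewrite -natrM XY0 mulr0 => _.
  by move/eqP: EN; rewrite XY0 addn_eq0 => /andP[_ /eqP->].
have {}EN : E%:R + N%:R = #|X|%:R * #|Y|%:R :> R by rewrite -natrD EN natrM.
rewrite ler_pdivlMr -?EN ?EN -?natrM ?ltr0n // natrM; lra.
Qed.

(** * Restricting an m-sequence to a set of vertices *)

Section Restriction.

Variables (m : nat) (V : finType).
Implicit Types (chi : mseq m V) (U : {set V}).

Definition restrict chi U : mseq m V :=
  MSeq (fun i => blocks chi i :&: U)
       (fun i => [seq X :&: U | X <- parts chi i]).

Lemma vertices_restrict chi U : vertices (restrict chi U) \subset vertices chi.
Proof.
by apply/bigcupsP=> i _; rewrite (subset_trans (subsetIl _ _)) ?(bigcup_sup i).
Qed.

Lemma long_rep_restrict (v : m.-tuple bool) chi U :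
  long_rep v (restrict chi U) = [seq X :&: U | X <- long_rep v chi].
Proof.
rewrite /long_rep map_flatten -map_comp; congr flatten.
by apply: eq_map => i /=; case: ifP.
Qed.

Lemma nth_long_rep_restrict (v : m.-tuple bool) chi U s :
  nth set0 (long_rep v (restrict chi U)) s = nth set0 (long_rep v chi) s :&: U.
Proof.
rewrite long_rep_restrict; have [lt_s|le_s] := ltnP s (size (long_rep v chi)).
  by rewrite (nth_map set0).
by rewrite !nth_default ?size_map // set0I.
Qed.

Lemma part_in_long_rep (v : m.-tuple bool) chi i X :
  tnth v i -> X \in parts chi i -> X \in long_rep v chi.
Proof.
by move=> vi Xi; apply/flatten_mapP; exists i; rewrite ?mem_enum // vi.
Qed.

Lemma block_in_long_rep (v : m.-tuple bool) chi i :
  ~~ tnth v i -> blocks chi i \in long_rep v chi.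
Proof.
by move=> /negPf vi; apply/flatten_mapP; exists i; rewrite ?mem_enum // vi inE.
Qed.

End Restriction.

Lemma has_strong_pair_restrict (R : realType) (m : nat) (V : finType)
    (e : rel V) (chi : mseq m V) (U : {set V}) (c : R) :
  has_strong_pair e (restrict chi U) c -> has_strong_pair e chi c.
Proof.
have sub := vertices_restrict chi U.
case=> A [B [[sA sB dAB] AB]]; exists A, B; split=> //; split=> //.
  exact: subset_trans sA sub.
exact: subset_trans sB sub.
Qed.

Lemma has_strong_pair_le (R : realType) (m : nat) (V : finType)
    (e : rel V) (chi : mseq m V) (c c' : R) : c' <= c ->
  has_strong_pair e chi c -> has_strong_pair e chi c'.
Proof.
move=> le_c' [A [B [sAB [hA hB dAB]]]]; exists A, B; split=> //.
have le_cn (n : nat) : c' * n%:R <= c * n%:R by rewrite ler_wpM2r.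
split=> //; first exact: le_trans hA.
by case: hB => [hB|[tB hB]]; [left|right; split=> //]; apply: le_trans hB.
Qed.

Lemma transitive_setS (V : finType) (e : rel V) (S S' : {set V}) :
  S' \subset S -> transitive_set e S -> transitive_set e S'.
Proof. by move=> /subsetP sS tS p p0 sp; apply: tS => // x /sp /sS. Qed.

Lemma leq_card_tr (V : finType) (e : rel V) (S : {set V}) :
  transitive_set e S -> (#|S| <= tr e)%N.
Proof.
by move=> tS; apply: (@leq_bigmax_cond _ _ (fun S : {set V} => #|S|)); apply/asboolP.
Qed.

(** A singleton is transitive: a cycle of length one would be a loop, and a longer one would repeat
    the vertex. *)
Lemma tr_gt0 (V : finType) (e : rel V) : is_tournament e -> (0 < tr e)%N.
Proof.
case=> /card_gt0P[x _] irr _.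
have -> : 1%N = #|[set x]| by rewrite cards1.
apply: leq_card_tr => -[//|y p] _ sp.
have yx : y = x by apply/set1P/sp/mem_head.
case: p sp => [|z p] sp; rewrite /ucycle /=; first by rewrite irr.
have zx : z = x by apply/set1P/sp; rewrite !inE eqxx orbT.
by rewrite yx zx mem_head andbF.
Qed.

(** Nonempty traces serve twice: they keep [set0] out of the new partition, and with disjointness
    they make [X :&: U] determine [X], so the list stays duplicate-free. *)
Lemma partition_restrict (V : finType) (P : seq {set V}) (S U : {set V}) :
  uniq P -> partition [set X in P] S ->
  (forall X, X \in P -> X :&: U != set0) ->
  uniq [seq X :&: U | X <- P] /\
  partition [set X in [seq X :&: U | X <- P]] (S :&: U).
Proof.
move=> uP /and3P[/eqP covP /trivIsetP trivP _] ne0.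
have inj X Y x : X \in P -> Y \in P -> x \in X -> x \in Y -> X = Y.
  move=> XP YP xX xY; apply/eqP/negPn/negP=> /trivP; rewrite !inE => /(_ XP YP).
  by move=> /pred0P/(_ x) /=; rewrite xX xY.
split.
  rewrite map_inj_in_uniq // => X Y XP YP eqU.
  have /set0Pn[x xX] := ne0 X XP; have := xX; rewrite eqU.
  by case/setIP: xX => xX _ /setIP[xY _]; apply: inj xX xY.
apply/and3P; split.
- rewrite -covP; apply/eqP/setP=> x; apply/bigcupP/setIP.
    case=> Y; rewrite inE => /mapP[X XP ->] /setIP[xX xU]; split=> //.
    by apply/bigcupP; exists X; rewrite ?inE.
  case=> /bigcupP[X]; rewrite inE => XP xX xU.
  by exists (X :&: U); rewrite inE ?xX //; apply/mapP; exists X.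
- apply/trivIsetP=> X' Y'; rewrite !inE => /mapP[X XP ->] /mapP[Y YP ->] neq.
  apply/pred0P=> x /=; apply/negP=> /andP[/setIP[xX _] /setIP[xY _]].
  by case/negP: neq; rewrite (inj X Y x).
- by rewrite inE; apply/negP=> /mapP[X /ne0 + eq0]; rewrite -eq0 eqxx.
Qed.

(** Keeping a quarter of each set costs a factor 4 in [c]. A single forward edge between two blocks
    gives density at least the inverse of [#|V| ^ 2], whence the new, still smaller than 1, value of
    lambda. *)
Lemma restrict_mseq (R : realType) (m : nat) (v : m.-tuple bool)
    (eta : (zeta v m).-tuple nat) (c lambda : R) (V : finType) (e : rel V)
    (chi : mseq m V) (U : {set V}) :
  is_tournament e -> is_mseq eta c lambda e chi ->
  (forall X, X \in long_rep v chi -> #|X|%:R <= 4 * #|X :&: U|%:R :> R) ->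
  (forall i j : 'I_m, (i < j)%N ->
     exists x y, [/\ x \in blocks chi i :&: U, y \in blocks chi j :&: U & e x y]) ->
  is_mseq eta (c / 4) (1 - (#|V|%:R * #|V|%:R)^-1) e (restrict chi U).
Proof.
move=> tour [[c_gt0 _] disj transP bigP _] large edge.
have V_gt0 : 1 <= #|V|%:R :> R by case: tour => *; rewrite ler1n.
have VV_ge1 : 1 <= #|V|%:R * #|V|%:R :> R by nra.
have VV_gt0 : 0 < #|V|%:R * #|V|%:R :> R by lra.
have tr_pos : 0 < (tr e)%:R :> R by rewrite ltr0n tr_gt0.
split.
- have := invf_le1 VV_gt0; rewrite VV_ge1 => inv_le1.
  have : 0 < (#|V|%:R * #|V|%:R)^-1 :> R by rewrite invr_gt0.
  by split; lra.
- move=> i j /disj; apply: disjointW; exact: subsetIl.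
- move=> i vi; have [tS szP [uP partP] comp sz] := transP i vi.
  have szU X : X \in parts chi i -> c / 4 * (tr e)%:R <= #|X :&: U|%:R.
    by move=> XP; have := sz X XP; have := large X (part_in_long_rep vi XP); lra.
  split.
  + exact: transitive_setS (subsetIl _ _) tS.
  + by rewrite size_map.
  + apply: partition_restrict => // X /szU XU; rewrite -card_gt0 -(ltr0n R).
    by apply: lt_le_trans XU; rewrite mulr_gt0 // divr_gt0.
  + move=> a b; rewrite size_map => /andP[ab bs] x y.
    rewrite !(nth_map set0) ?(ltn_trans ab) // => /setIP[xa _] /setIP[yb _].
    by apply: comp xa yb; rewrite ab.
  + by move=> _ /mapP[X XP ->]; apply: szU.
- move=> i vi; have := bigP i vi; have := large _ (block_in_long_rep chi vi) => /=; lra.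
- move=> i j /edge[x [y [xi yj exy]]]; rewrite subKr /density /=.
  set E := [set p in _ | _]; have E_gt0 : 1 <= #|E|%:R :> R.
    by rewrite ler1n card_gt0; apply/set0Pn; exists (x, y); rewrite inE in_setX xi yj.
  have X_gt0 : 1 <= #|blocks chi i :&: U|%:R :> R.
    by rewrite ler1n card_gt0; apply/set0Pn; exists x.
  have Y_gt0 : 1 <= #|blocks chi j :&: U|%:R :> R.
    by rewrite ler1n card_gt0; apply/set0Pn; exists y.
  have XV : #|blocks chi i :&: U|%:R <= #|V|%:R :> R by rewrite ler_nat max_card.
  have YV : #|blocks chi j :&: U|%:R <= #|V|%:R :> R by rewrite ler_nat max_card.
  rewrite ler_pdivlMr; last by nra.
  by apply: le_trans E_gt0; rewrite mulrC ler_pdivrMr // mul1r ler_pM.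
Qed.

(** * Choosing the copies one after the other *)

Lemma card_bigcup_le (I : finType) (V : finType) (P : pred I) (F : I -> {set V}) :
  (#|\bigcup_(i | P i) F i| <= \sum_(i | P i) #|F i|)%N.
Proof.
elim/big_rec2: _ => [|i n A _ le_An]; first by rewrite cards0.
by rewrite (leq_trans (leq_card_setU _ _)) // leq_add2l.
Qed.

(** [P i] stands for being a copy of the [i]-th digraph. In each [Y] of [L], leaving [U0] loses at
    most half of [Y], and the bad neighbours of the typical vertices chosen so far at most another
    quarter, as there are at most [\sum_i n i] of these vertices. *)
Lemma greedy_choice (R : realType) (V : finType) (x0 : V) (bad : rel V)
    (L : seq {set V}) (U0 : {set V}) (eps : R) (r : nat) (n : 'I_r -> nat)
    (P : forall i : 'I_r, ('I_(n i) -> V) -> Prop) :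
  symmetric bad -> U0 \subset typical bad L eps ->
  (forall Y, Y \in L -> 2 * #|Y :\: U0|%:R <= #|Y|%:R :> R) ->
  0 <= eps -> 4 * eps * (\sum_i n i)%N%:R <= 1 ->
  (forall U : {set V}, U \subset U0 ->
     (forall Y, Y \in L -> #|Y|%:R <= 4 * #|Y :&: U|%:R :> R) ->
     forall i, exists2 y, P i y & forall a, y a \in U) ->
  exists x : forall i : 'I_r, 'I_(n i) -> V,
    (forall i, P i (x i)) /\
    (forall i i', i != i' -> forall a b, ~~ bad (x i a) (x i' b)).
Proof.
move=> bad_sym /subsetP typU0 largeU0 eps_ge0 eps_le extend.
(* Induction on the number [k] of copies already chosen; only pairs [i < i'] are tracked, symmetry
   of [bad] giving the others. *)
suff : forall k, (k <= r)%N -> exists x : forall i : 'I_r, 'I_(n i) -> V,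
    [/\ forall i : 'I_r, (i < k)%N -> P i (x i),
        forall i : 'I_r, (i < k)%N -> forall a, x i a \in U0
      & forall i i' : 'I_r, (i < i' < k)%N -> forall a b, ~~ bad (x i a) (x i' b)].
  move=> /(_ r (leqnn r))[x [Px _ badx]]; exists x; split=> [i|i i' neq a b]; first exact: Px.
  have [lt_ii'|lt_i'i|/val_inj eq_ii'] := ltngtP i i'.
  - by apply: badx; rewrite lt_ii' ltn_ord.
  - by rewrite bad_sym; apply: badx; rewrite lt_i'i ltn_ord.
  - by rewrite eq_ii' eqxx in neq.
elim=> [_|k IHk lt_kr].
  (* [x0] is a filler for the copies not yet chosen. *)
  by exists (fun _ _ => x0); split=> // i i'; rewrite ltn0 andbF.
have [x [Px xU0 badx]] := IHk (ltnW lt_kr).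
(* [B] consists of all bad neighbours of the vertices already chosen; the next copy must avoid
   it. *)
pose B := \bigcup_(i < r | (i < k)%N) \bigcup_(a < n i) [set y | bad (x i a) y].
have UU0 : U0 :\: B \subset U0 by apply: subsetDl.
have large Y : Y \in L -> #|Y|%:R <= 4 * #|Y :&: (U0 :\: B)|%:R :> R.
  move=> YL; have := largeU0 Y YL.
  have cardB : #|Y :&: B|%:R <= eps * #|Y|%:R * (\sum_i n i)%N%:R.
    have -> : Y :&: B = \bigcup_(i < r | (i < k)%N)
        \bigcup_(a < n i) [set y in Y | bad (x i a) y].
      rewrite /B big_distrr /=; apply: eq_bigr => i _.
      by rewrite big_distrr /=; apply: eq_bigr => a _; apply/setP=> y; rewrite !inE.
    rewrite natr_sum mulr_sumr.
    apply: le_trans (_ : \sum_(i < r | (i < k)%N) eps * #|Y|%:R * (n i)%:R <= _);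
      last by rewrite [leRHS](bigID (fun i : 'I_r => (i < k)%N)) /= lerDl
                sumr_ge0 // => i _; rewrite !mulr_ge0.
    apply: le_trans (_ : (\sum_(i < r | (i < k)%N)
        #|\bigcup_(a < n i) [set y in Y | bad (x i a) y]|)%N%:R <= _).
      by rewrite ler_nat card_bigcup_le.
    rewrite natr_sum; apply: ler_sum => i lt_ik.
    apply: le_trans (_ : (\sum_(a < n i) #|[set y in Y | bad (x i a) y]|)%N%:R <= _).
      by rewrite ler_nat card_bigcup_le.
    rewrite natr_sum mulr_natr -[X in _ *+ X]card_ord -sumr_const.
    apply: ler_sum => a _.
    by have := typU0 _ (xU0 i lt_ik a); rewrite inE => /allP/(_ Y YL).
  have card_le : #|Y|%:R <= #|Y :&: (U0 :\: B)|%:R + #|Y :\: U0|%:R + #|Y :&: B|%:R :> R.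
    rewrite -!natrD ler_nat.
    have sub : Y \subset (Y :&: (U0 :\: B)) :|: (Y :\: U0) :|: (Y :&: B).
      apply/subsetP=> y; rewrite !inE => ->; rewrite /= !andbT.
      by case: (y \in U0); case: (y \in B).
    apply: leq_trans (subset_leq_card sub) _.
    by rewrite (leq_trans (leq_card_setU _ _)) // leq_add2r leq_card_setU.
  have : 4 * (eps * #|Y|%:R * (\sum_i n i)%N%:R) <= #|Y|%:R.
    by rewrite -[leRHS]mul1r mulrAC mulrA ler_wpM2r // mulrA.
  lra.
have [y Py yU] := extend _ UU0 large (Ordinal lt_kr).
set ik := Ordinal lt_kr in y Py yU.
have lt_k i : ik != i -> (i < k.+1)%N -> (i < k)%N.
  by rewrite ltnS leq_eqVlt => neq /orP[/eqP eq_ik|//]; case/eqP: neq; apply: val_inj.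
exists (dfwith x y); split.
- move=> i lt_ik; have [<-|neq] := eqVneq ik i; first by rewrite dfwith_in.
  by rewrite dfwith_out //; apply/Px/lt_k.
- move=> i lt_ik a; have [eq_i|neq] := eqVneq ik i; last first.
    by rewrite dfwith_out //; apply/xU0/lt_k.
  (* The type of [a] depends on [i], so the equality has to be eliminated before [dfwith] can be
     evaluated. *)
  by case: i / eq_i lt_ik a => _ a; rewrite dfwith_in (subsetP UU0).
- move=> i i' /andP[lt_ii' lt_i'k] a b.
  have lt_ik : (i < k)%N by rewrite (leq_trans lt_ii').
  have neq_i : ik != i by rewrite -val_eqE /= gtn_eqF.
  rewrite (dfwith_out _ _ neq_i).
  have [eq_i'|neq] := eqVneq ik i'; last first.
    by rewrite dfwith_out //; apply: badx; rewrite lt_ii' lt_k.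
  case: i' / eq_i' b {lt_i'k lt_ii'} => b; rewrite dfwith_in.
  have := yU b; rewrite in_setD => /andP[+ _]; apply: contra => bad_ab.
  by apply/bigcupP; exists i => //; apply/bigcupP; exists a; rewrite ?inE.
Qed.

(** * Wrongly oriented pairs in the long representation *)

Section LongRep.

Variables (R : realType) (m : nat) (v : m.-tuple bool).
Variables (eta : (zeta v m).-tuple nat) (c lambda : R).
Variables (V : finType) (e : rel V) (chi : mseq m V).
Hypothesis (chiP : is_mseq eta c lambda e chi).

(** [long_rep v chi] is the concatenation of these lists. *)
Definition pieces (i : 'I_m) : seq {set V} :=
  if tnth v i then parts chi i else [:: blocks chi i].

Notation nonedges X Y := (\sum_(x in X) degree_in (fun x y => ~~ e x y) x Y)%N.

Lemma size_long_rep :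
  size (long_rep v chi) =
  (\sum_(i < m) if tnth v i then nth 0%N eta (zeta v i) else 1)%N.
Proof.
case: chiP => _ _ transP _ _.
rewrite size_flatten sumnE big_map big_map big_enum /=; apply: eq_bigr => i _.
by case: ifP => // vi; have [] := transP i vi.
Qed.

Lemma piece_sub i X : X \in pieces i -> X \subset blocks chi i.
Proof.
rewrite /pieces; case: chiP => _ _ transP _ _; case: ifP => [vi XP|_].
  have [_ _ [_ /and3P[/eqP <- _ _]] _ _] := transP i vi.
  by rewrite (bigcup_sup X) ?inE.
by rewrite inE => /eqP->.
Qed.

(** A split block is transitive, so its size is at most [tr e] and each part has at least [c * tr e]
    vertices. An unsplit block is its own piece, and [#|V|] takes the place of [tr e]. *)
Lemma piece_large i X :
  X \in pieces i -> c * #|blocks chi i|%:R <= #|X|%:R.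
Proof.
rewrite /pieces; case: chiP => -[c_gt0 _] _ transP bigP _; case: ifP => [vi XP|/negbT vi].
  have [/leq_card_tr le_tr _ _ _ /(_ X XP)] := transP i vi.
  by apply: le_trans; rewrite ler_pM2l // ler_nat.
rewrite inE => /eqP->; apply: le_trans (bigP i vi).
by rewrite ler_pM2l // ler_nat max_card.
Qed.

Lemma piece_exists i x : x \in blocks chi i -> exists2 X, X \in pieces i & x \in X.
Proof.
rewrite /pieces; case: chiP => _ _ transP _ _; case: ifP => [vi|_].
  have [_ _ [_ /and3P[/eqP <- _ _]] _ _] := transP i vi.
  by case/bigcupP=> X; rewrite inE; exists X.
by exists (blocks chi i); rewrite ?inE.
Qed.

Lemma mem_pieces i X : X \in pieces i -> X \in long_rep v chi.
Proof. by move=> Xi; apply/flatten_mapP; exists i; rewrite ?mem_enum. Qed.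

(** All non-edges between the blocks may fall into [X] and [Y]; as each piece is at least a fraction
    [c] of its block, their proportion grows by at most [c ^- 2]. *)
Lemma nonedges_pieces (i j : 'I_m) X Y : (i < j)%N -> X \in pieces i -> Y \in pieces j ->
  (nonedges X Y)%:R <= lambda / c ^+ 2 * (#|X|%:R * #|Y|%:R).
Proof.
move=> lt_ij Xi Yj; have := piece_large Xi; have := piece_large Yj.
case: chiP => -[c_gt0 /andP[lam_ge0 _]] _ _ _ /(_ i j lt_ij)/nonedges_density.
have := sum_degree_inS (fun x y => ~~ e x y) (piece_sub Xi) (piece_sub Yj).
rewrite -(ler_nat R) => le1 le2 leY leX; apply: le_trans le1 (le_trans le2 _).
rewrite -mulrA ler_wpM2l // [leRHS]mulrC ler_pdivlMr ?exprn_gt0 //.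
rewrite (_ : _ * _ * _ = (c * #|blocks chi i|%:R) * (c * #|blocks chi j|%:R));
  last by ring.
by rewrite ler_pM // mulr_ge0 // ltW.
Qed.

(** An empty block would make the density 0, against [lambda < 1]. *)
Lemma block_neq0 (i j : 'I_m) : (i < j)%N ->
  blocks chi i != set0 /\ blocks chi j != set0.
Proof.
case: chiP => -[_ /andP[_ lam_lt1]] _ _ _ dens /dens; rewrite /density => le_d.
by split; apply/negP=> /eqP Z; move: le_d; rewrite Z cards0 ?mul0r ?mulr0 invr0 mulr0; lra.
Qed.

(** Inside one block completeness leaves no non-edges at all; across blocks [nonedges_pieces]
    applies. *)
Lemma long_rep_pairwise :
  pairwise (fun X Y : {set V} => [disjoint X & Y] &&
    ((nonedges X Y)%:R <= lambda / c ^+ 2 * (#|X|%:R * #|Y|%:R)))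
    (long_rep v chi).
Proof.
case: (chiP) => -[c_gt0 /andP[lam_ge0 _]] disj transP _ _.
apply: (@pairwise_flatten_map _ _ (fun i j : 'I_m => (i < j)%N)).
- rewrite -[pairwise _ _](pairwise_map val ltn) val_enum_ord.
  by rewrite -sorted_pairwise ?iota_ltn_sorted //; apply: ltn_trans.
- move=> i; case: ifP => // vi.
  have [_ _ [uP /and3P[_ /trivIsetP trivP _]] comp _] := transP i vi.
  apply/(pairwiseP set0) => a b; rewrite !inE => lt_a lt_b lt_ab.
  rewrite trivP ?inE ?mem_nth ?nth_uniq ?ltn_eqF //=.
  rewrite big1 ?mulr_ge0 ?invr_ge0 ?exprn_ge0 ?(ltW c_gt0) // => x xa.
  apply/eqP; rewrite cards_eq0; apply/eqP/setP=> y; rewrite !inE.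
  apply/negP=> /andP[yb /negP[]]; apply: comp xa yb; by rewrite lt_ab.
- move=> i j lt_ij; apply/allrelP=> X Y Xi Yj; rewrite (nonedges_pieces lt_ij) // andbT.
  apply: disjointW (piece_sub Xi) (piece_sub Yj) _.
  by apply: disj; rewrite -val_eqE /= ltn_eqF.
Qed.

(** When the members of [L] are disjoint, the first one containing [x] is the only one. *)
Definition index_in (L : seq {set V}) (x : V) : nat :=
  find (fun X : {set V} => x \in X) L.

(** Made symmetric so that one degree bound controls both the earlier and the later sets; two
    vertices of the same index are never misordered. *)
Definition misordered (L : seq {set V}) : rel V := fun x y =>
  (index_in L x < index_in L y)%N && ~~ e x y ||
  (index_in L y < index_in L x)%N && ~~ e y x.

Lemma misordered_sym L : symmetric (misordered L).
Proof. by move=> x y; rewrite /misordered orbC. Qed.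

Lemma index_long_rep s x :
  x \in nth set0 (long_rep v chi) s -> index_in (long_rep v chi) x = s.
Proof.
have /(pairwiseP set0) pw := long_rep_pairwise; set L := long_rep v chi in pw *.
(* Beyond the end of the list [nth] returns [set0], which cannot contain [x]. *)
move=> xs; have lt_s : (s < size L)%N.
  by rewrite ltnNge; apply/negP=> le_s; move: xs; rewrite nth_default ?inE.
have hasx : has (fun X : {set V} => x \in X) L.
  by apply/hasP; exists (nth set0 L s); rewrite ?mem_nth.
have lt_i : (index_in L x < size L)%N by rewrite -has_find.
have xi : x \in nth set0 L (index_in L x) by apply: (nth_find set0 hasx).
have [lt|lt|//] := ltngtP (index_in L x) s.
- by have /andP[/pred0P/(_ x)] := pw _ _ lt_i lt_s lt; rewrite /= xi xs.
- by have /andP[/pred0P/(_ x)] := pw _ _ lt_s lt_i lt; rewrite /= xi xs.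
Qed.

Lemma sum_misordered X Y : X \in long_rep v chi -> Y \in long_rep v chi ->
  (\sum_(x in X) degree_in (misordered (long_rep v chi)) x Y)%N%:R
    <= lambda / c ^+ 2 * (#|X|%:R * #|Y|%:R).
Proof.
have /(pairwiseP set0) pw := long_rep_pairwise.
case: (chiP) => -[c_gt0 /andP[lam_ge0 _]] _ _ _ _.
have idx := index_long_rep; set L := long_rep v chi in pw idx *.
move=> /(nthP set0)[s lt_s <-] /(nthP set0)[t lt_t <-].
have [lt_st|lt_ts|<-] := ltngtP s t.
- have /andP[_] := pw s t lt_s lt_t lt_st; congr (_%:R <= _).
  rewrite !sum_degree_in; apply: eq_bigr => x /idx xs; apply: eq_bigr => y /idx yt.
  by rewrite /misordered xs yt lt_st ltnNge (ltnW lt_st) orbF.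
- have /andP[_] := pw t s lt_t lt_s lt_ts; rewrite [X in _ * X]mulrC.
  congr (_%:R <= _); rewrite !sum_degree_in exchange_big /=.
  apply: eq_bigr => x /idx xs; apply: eq_bigr => y /idx yt.
  by rewrite /misordered xs yt lt_ts ltnNge (ltnW lt_ts).
- rewrite sum_degree_in big1 ?mulr_ge0 ?invr_ge0 ?exprn_ge0 ?(ltW c_gt0) //.
  move=> x /idx xs; rewrite big1 // => y /idx yt.
  by rewrite /misordered xs yt ltnn.
Qed.

(** Without such an edge, for pieces [X] and [Y] of the two blocks all pairs of [X :&: U] and
    [Y :&: U] are non-edges. These are at least a sixteenth of all pairs of [X] and [Y], more than
    the proportion [lambda / c ^+ 2] allowed. *)
Lemma restricted_edge U (i j : 'I_m) : 16 * lambda < c ^+ 2 ->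
  (forall X, X \in long_rep v chi -> #|X|%:R <= 4 * #|X :&: U|%:R :> R) ->
  (i < j)%N ->
  exists x y, [/\ x \in blocks chi i :&: U, y \in blocks chi j :&: U & e x y].
Proof.
move=> lam_small large lt_ij.
have [/set0Pn[x0 /piece_exists[X Xi xX]]] := block_neq0 lt_ij.
move=> /set0Pn[y0 /piece_exists[Y Yj yY]].
apply: contrapT => no_edge.
have := card_edges e (X :&: U) (Y :&: U); rewrite (_ : [set _ in _ | _] = set0).
  rewrite cards0 add0n => eq_ne.
  have := sum_degree_inS (fun x y => ~~ e x y) (subsetIl X U) (subsetIl Y U).
  rewrite eq_ne -(ler_nat R) natrM => le1.
  have le2 := nonedges_pieces lt_ij Xi Yj.
  have X_gt0 : 0 < #|X|%:R :> R by rewrite ltr0n card_gt0; apply/set0Pn; exists x0.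
  have Y_gt0 : 0 < #|Y|%:R :> R by rewrite ltr0n card_gt0; apply/set0Pn; exists y0.
  have leX := large X (mem_pieces Xi); have leY := large Y (mem_pieces Yj).
  have XY_gt0 := mulr_gt0 X_gt0 Y_gt0.
  have le3 : #|X|%:R * #|Y|%:R <= (4 * #|X :&: U|%:R) * (4 * #|Y :&: U|%:R) :> R.
    by rewrite ler_pM.
  have c_gt0 : 0 < c by case: chiP => -[].
  have : lambda / c ^+ 2 * 16 < 1.
    by rewrite mulrAC ltr_pdivrMr ?exprn_gt0 // mul1r mulrC.
  rewrite -(ltr_pM2r XY_gt0); lra.
apply/setP=> -[x y]; rewrite !inE /=; apply/negP.
move=> /andP[/andP[/andP[xX' xU] /andP[yY' yU]] exy].
apply: no_edge; exists x, y; rewrite !inE xU yU.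
by rewrite (subsetP (piece_sub Xi)) // (subsetP (piece_sub Yj)).
Qed.

End LongRep.

(** * Choice of the constants and construction of the copies *)

Theorem theorem13 (R : realType) (m : nat) (v : m.-tuple bool)
    (eta : (zeta v m).-tuple nat) (eta_gt0 : forall i, (0 < tnth eta i)%N)
    (r : nat) (n : 'I_r -> nat) (D : forall i : 'I_r, rel 'I_(n i))
    (phi : forall i : 'I_r, 'I_(n i) -> 'I_(long_size eta))
    (phi_inj : forall i, injective (phi i))
    (phi_disj : forall i j, i != j -> forall a b, phi i a != phi j b)
    (D_proper : forall i, proper_digraph R (D i) (phi i)) :
  forall c : R, 0 < c ->
  exists lambda0 c1 : R, [/\ 0 < lambda0, 0 < c1 &
  forall (V : finType) (e : rel V), is_tournament e ->
  forall lambda : R, 0 < lambda <= lambda0 ->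
  forall chi : mseq m V, is_mseq eta c lambda e chi ->
    has_strong_pair e chi c1 \/
    exists x : forall i : 'I_r, 'I_(n i) -> V,
      [/\ forall i j, x i j \in nth set0 (long_rep v chi) (phi i j),
          forall i a b, D i a b -> e (x i a) (x i b)
        & forall i i', i != i' -> forall a b,
            (phi i' b < phi i a)%N -> ~~ e (x i a) (x i' b)]].

Proof.
move=> c c_gt0; have c4_gt0 : 0 < c / 4 by rewrite divr_gt0.
have /choice[c1 c1P] : forall i, exists c1 : R, 0 < c1 /\
  forall (V : finType) (e : rel V), is_tournament e ->
  forall lambda : R, 0 <= lambda < 1 ->
  forall chi : mseq m V, is_mseq eta (c / 4) lambda e chi ->
    (exists x : 'I_(n i) -> V,
        (forall j, x j \in nth set0 (long_rep v chi) (phi i j)) /\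
        (forall a b, D i a b -> e (x a) (x b))) \/
    has_strong_pair e chi c1.
  by move=> i; have [c1 c1_gt0 c1P] := D_proper i _ c4_gt0; exists c1.
pose N := (\sum_i n i)%N.
(* The length of every long representation, written without [chi] because [lambda0] may depend on
   it. *)
pose K := (\sum_(i < m) if tnth v i then nth 0%N eta (zeta v i) else 1)%N.
(* This gives [4 * eps * N <= 1] for the greedy choice; [eps <= 1/8] later yields
   [16 * lambda < c ^+ 2]. The successor avoids dividing by 0. *)
pose eps : R := 8^-1 / N.+1%:R.
have eps_gt0 : 0 < eps by rewrite divr_gt0 // invr_gt0.
(* Chosen so that the proportion [lambda / c ^+ 2] of misordered pairs, summed over the [K] sets,
   stays below [eps / 4]. *)
pose lambda0 : R := c ^+ 2 * (eps / (4 * K.+1%:R)).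
have c2_gt0 : 0 < c ^+ 2 by rewrite exprn_gt0.
have K_gt0 : 0 < 4 * K.+1%:R :> R by rewrite mulr_gt0.
(* The value 1 keeps the minimum positive even if [r = 0]. *)
exists lambda0, (\big[Num.min/1]_i c1 i); split.
- by rewrite mulr_gt0 // divr_gt0.
- by apply: lt_bigmin => // i _; have [] := c1P i.
move=> V e tour lambda /andP[lam_gt0 lam_le] chi chiP.
have [|no_pair] := EM (has_strong_pair e chi (\big[Num.min/1]_i c1 i));
  [by left|right].
have eps_eq : eps * N%:R + eps = 8^-1.
  by rewrite -[X in _ + X]mulr1 -mulrDr natr1 /eps divfK // pnatr_eq0.
have epsN_ge0 : 0 <= eps * N%:R by rewrite mulr_ge0 // ltW.
have epsN : 4 * eps * N%:R <= 1 by lra.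
pose delta := lambda / c ^+ 2.
have delta_gt0 : 0 < delta by rewrite divr_gt0.
have deltaK_ge0 : 0 <= delta * K%:R by rewrite mulr_ge0 // ltW.
have delta_le : 4 * (delta * K%:R + delta) <= eps.
  rewrite -[X in _ + X]mulr1 -mulrDr natr1 mulrCA -ler_pdivlMr //.
  by rewrite /delta ler_pdivrMr // mulrC.
have lam_eq : lambda = delta * c ^+ 2 by rewrite /delta divfK // gt_eqF.
have lam_small : 16 * lambda < c ^+ 2.
  by rewrite lam_eq mulrA -[ltRHS]mul1r ltr_pM2r //; lra.
set L := long_rep v chi; pose U0 := typical (misordered e L) L eps.
(* At most a proportion [K * delta / eps] of [Y] is atypical, and [delta_le] makes this less than a
   half. *)
have largeU0 Y : Y \in L -> 2 * #|Y :\: U0|%:R <= #|Y|%:R :> R.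
  move=> YL; have := card_atypical eps_gt0 (ltW delta_gt0)
    (fun Z => sum_misordered chiP YL (Y := Z)).
  rewrite (size_long_rep chiP) -/K -/U0 => le_at.
  rewrite -(ler_pM2r eps_gt0).
  have : 2 * (delta * K%:R) * #|Y|%:R <= eps * #|Y|%:R by rewrite ler_wpM2r //; lra.
  move: le_at; lra.
have [x0 _] : exists x0 : V, x0 \in V by case: tour => /card_gt0P.
have [|x [xP ordx]] := greedy_choice (P := fun i y =>
    (forall j, y j \in nth set0 L (phi i j)) /\ (forall a b, D i a b -> e (y a) (y b)))
  x0 (misordered_sym e L) (subxx U0) largeU0 (ltW eps_gt0) epsN.
  move=> U _ large i; have [_ c1iP] := c1P i.
  have chiUP := restrict_mseq tour chiP large
    (fun i j lt_ij => restricted_edge chiP lam_small large lt_ij).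
  have [[_ lamU] _ _ _ _] := chiUP.
  (* A strong pair of the restriction is one of [chi], which is excluded; so the copy exists inside
     [U]. *)
  have [[y [yL yD]]|pairU] := c1iP V e tour _ lamU _ chiUP; last first.
    case: no_pair; apply: has_strong_pair_le (has_strong_pair_restrict pairU).
    exact: bigmin_le.
  have {}yL j : y j \in nth set0 L (phi i j) :&: U.
    by rewrite -nth_long_rep_restrict.
  by exists y => [|j]; [split=> // j|]; have /setIP[] := yL j.
exists x; split=> [i j|i a b|i i' neq a b lt_ba].
- by have [] := xP i.
- by have [_] := xP i; apply.
(* The pair is not misordered, so the edge goes from the earlier set to the later one, and a
   tournament has no edge back. *)
- have [/(_ a)/(index_long_rep chiP) ia _] := xP i.
  have [/(_ b)/(index_long_rep chiP) ib _] := xP i'.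
  have := ordx i i' neq a b; rewrite /misordered ia ib.
  rewrite lt_ba ltnNge (ltnW lt_ba) /= negbK => eba.
  case: tour => _ irr tourE; rewrite -tourE //.
  by apply: contraTneq eba => ->; rewrite irr.
Qed.
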